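(* Let $a\in\mathbb{R}$, let $1<\nu<2$, and let $f:\mathbb{N}_a\to\mathbb{R}$ be such that $${}^{C}\Delta_a^{\nu}f(t)\ge -\frac{(t-a)^{(-\nu)}}{\Gamma(1-\nu)}f(a)-\frac{(t-a)^{(1-\nu)}}{\Gamma(2-\nu)}\Delta f(a)\quad\text{for each } t\in\mathbb{N}_{a+2-\nu}.$$ If $f(a+1)\ge \frac{\nu}{k+1}f(a)$ for each $k\in\mathbb{N}_0$, then $\Delta f(t)\ge 0$ for all $t\in\mathbb{N}_{a+1}$.
   Context: For a real number $c$, $\mathbb{N}_c=\{c,c+1,c+2,\dots\}$. $\Delta f(t)=f(t+1)-f(t)$, $\Delta^m=\Delta(\Delta^{m-1})$, $\sigma(s)=s+1$. The falling function is $x^{(\beta)}=\Gamma(x+1)/\Gamma(x+1-\beta)$, with the convention that division at a pole yields zero. For $1<\nu<2$ (so $n=[\nu]+1=2$) the delta left Caputo fractional difference starting from $a$ is $${}^{C}\Delta_a^{\nu}f(t)=\frac{1}{\Gamma(2-\nu)}\sum_{s=a}^{t-(2-\nu)}(t-\sigma(s))^{(1-\nu)}\Delta^2 f(s),\qquad t\in\mathbb{N}_{a+2-\nu}.$$ *)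

(* Defs.v *)
From HB Require Import structures.
From mathcomp Require Import all_boot all_order all_algebra.
From mathcomp Require Import all_classical all_reals all_analysis.
Set Implicit Arguments.
Unset Strict Implicit.
Unset Printing Implicit Defensive.
Import Order.TTheory GRing.Theory Num.Theory.
Import numFieldNormedType.Exports.
Local Open Scope classical_set_scope.
Local Open Scope ring_scope.

(* Functions on [Nset c] are represented by total functions [R -> R]; all the
   operators below only use their values on the relevant [Nset c]. *)
Definition Nset (R : realType) (c : R) : set R := [set c + k%:R | k in @setT nat].

Section fractional_difference.
Variable R : realType.
Implicit Types (x s t a b beta nu : R) (f : R -> R).

(* Euler's integral of the second kind, meaningful for 0 < x. *)
Definition Gamma_integral x : R :=
  \int[lebesgue_measure]_(t in `]0, +oo[) (t `^ (x - 1) * expR (- t)).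

(* Gamma(x) = Gamma(x + n) / (x (x + 1) ... (x + n - 1)) for x <= 0, where
   n is least such that 0 < x + n.  At a pole (x = 0, -1, -2, ...) the product
   vanishes and the value is the junk 0. *)
Definition Gamma x : R :=
  if 0 < x then Gamma_integral x
  else let n := (Num.truncn (- x)).+1 in
       Gamma_integral (x + n%:R) / \prod_(i < n) (x + i%:R).

Definition Gamma_pole x : bool := - x \is a Num.nat.

Definition falling x beta : R :=
  if Gamma_pole (x + 1 - beta) then 0
  else Gamma (x + 1) / Gamma (x + 1 - beta).

Definition delta f : R -> R := fun t => f (t + 1) - f t.

Definition sigma s : R := s + 1.

(* The sum over s = a, a + 1, ..., b, where b is in [Nset a]. *)
Definition delta_sum a b (F : R -> R) : R :=
  \sum_(s \in [set s | Nset a s /\ s <= b]) F s.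

(* The case 1 < nu < 2. *)
Definition caputo_delta a nu f t : R :=
  (Gamma (2 - nu))^-1 *
  delta_sum a (t - (2 - nu))
    (fun s => falling (t - sigma s) (1 - nu) * iter 2 delta f s).

End fractional_difference.

(* Main.v *)
(* With g_j = Delta f(a + j), g_(-1) = f(a) and b_i the coefficients of
   (1 - z)^(nu - 1), summation by parts turns the hypothesis at
   t = a + 2 - nu + m into the convolution inequality
   b_0 g_(m+1) + b_1 g_m + ... + b_(m+1) g_0 + b_(m+2) g_(-1) >= 0.
   Here b_0 = 1 and b_i <= 0 for i >= 1, while
   b_(m+2) = b_(m+1) (1 - nu / (m + 2)), so the last two terms add up to
   b_(m+1) (f(a + 1) - nu / (m + 2) f(a)) <= 0, and g_(m+1) >= 0 follows by
   strong induction on m.  The coefficients are quotients of Gamma values, for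
   which one needs Gamma(x + 1) = x Gamma(x), obtained from Euler's integral by
   parts on [1/n, n], and 0 < Gamma(x) < +oo on ]0, 1]. *)
Require Import Defs.
From mathcomp Require Import all_boot all_order all_algebra.
From mathcomp Require Import all_classical all_reals all_analysis.
From mathcomp Require Import measurable_realfun ring lra zify.
Set Implicit Arguments.
Unset Strict Implicit.
Unset Printing Implicit Defensive.
Import Order.TTheory GRing.Theory Num.Theory.
Import numFieldNormedType.Exports.
Local Open Scope classical_set_scope.
Local Open Scope ring_scope.

(** * Binomial coefficients of (1 - z)^(-x) and convolution with them *)

(* The coefficient of z^n in (1 - z)^(-x), i.e. Gamma(x + n) / (Gamma(x) n!). *)
Definition rising_binom (R : realType) (x : R) (n : nat) : R :=
  \prod_(i < n) ((x + i%:R) / i.+1%:R).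

Lemma rising_binom0 (R : realType) (x : R) : rising_binom x 0 = 1.
Proof. exact: big_ord0. Qed.

Lemma rising_binomS (R : realType) (x : R) (n : nat) :
  rising_binom x n.+1 = rising_binom x n * ((x + n%:R) / n.+1%:R).
Proof. exact: big_ord_recr. Qed.

(** Both sides are (x - 1) x ... (x + n - 1) / (n + 1)!. For 0 <= x <= 1 this isolates the one
    factor x - 1 that decides the sign. *)
Lemma rising_binom_pred (R : realType) (x : R) (n : nat) :
  rising_binom (x - 1) n.+1 = rising_binom x n * ((x - 1) / n.+1%:R).
Proof.
elim: n => [|n IHn]; first by rewrite rising_binomS !rising_binom0 addr0.
rewrite rising_binomS IHn rising_binomS.
by field; rewrite ?nat1r -?natrD ?pnatr_eq0.
Qed.

(** Compare coefficients in (1 - z)^(1 - x) = (1 - z) (1 - z)^(-x). *)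
Lemma rising_binom_diff (R : realType) (x : R) (n : nat) :
  rising_binom (x - 1) n.+1 = rising_binom x n.+1 - rising_binom x n.
Proof.
rewrite rising_binom_pred rising_binomS.
by field; rewrite ?nat1r -?natrD ?pnatr_eq0.
Qed.

Lemma rising_binom_ge0 (R : realType) (x : R) (n : nat) :
  0 <= x -> 0 <= rising_binom x n.
Proof. by move=> x0; apply: prodr_ge0 => i _; rewrite divr_ge0 ?addr_ge0. Qed.

Lemma rising_binom_pred_le0 (R : realType) (x : R) (n : nat) :
  0 <= x -> x <= 1 -> rising_binom (x - 1) n.+1 <= 0.
Proof.
move=> x0 x1; rewrite rising_binom_pred mulr_ge0_le0 ?rising_binom_ge0//.
by rewrite mulr_le0_ge0 ?subr_le0// invr_ge0.
Qed.

(** Summation by parts: the difference moves from [g] to the coefficients, lowering x to x - 1 and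
    leaving a boundary term at [g 0]. *)
Lemma rising_binom_conv_delta (R : realType) (x : R) (g : nat -> R) (m : nat) :
  \sum_(j < m.+1) rising_binom x (m - j) * (g j.+1 - g j) =
  \sum_(j < m.+2) rising_binom (x - 1) (m.+1 - j) * g j
  - rising_binom x m.+1 * g 0%N.
Proof.
have shift : \sum_(j < m.+1) rising_binom x (m - j) * g j.+1 =
    \sum_(j < m.+2) rising_binom x (m.+1 - j) * g j
    - rising_binom x m.+1 * g 0%N.
  by rewrite [in RHS]big_ord_recl/= subn0 addrAC subrr add0r.
under eq_bigr do rewrite mulrBr.
rewrite big_split/= sumrN shift addrAC; congr (_ - _).
rewrite !(big_ord_recr m.+1)/= subnn !rising_binom0 addrAC -sumrB.
congr (_ + _); apply: eq_bigr => j _.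
have jm : (j <= m)%N by rewrite -ltnS.
by rewrite subSn// rising_binom_diff mulrBl.
Qed.

(* [u] plays the role of [f(a)], which sits one step before [g 0]; the last
   hypothesis makes their joint contribution to the convolution nonpositive. *)
Lemma rising_binom_conv_ge0 (R : realType) (nu u : R) (g : nat -> R) :
  1 <= nu -> nu <= 2 ->
  (forall m, 0 <= \sum_(j < m.+2) rising_binom (1 - nu) (m.+1 - j) * g j
                  + rising_binom (1 - nu) m.+2 * u) ->
  (forall m, nu / m.+2%:R * u <= g 0%N + u) ->
  forall m, 0 <= g m.+1.
Proof.
move=> nu1 nu2 conv_ge0 g0_ge; have Enu : 1 - nu = (2 - nu) - 1 by lra.
have b_le0 n : rising_binom (1 - nu) n.+1 <= 0.
  by rewrite Enu rising_binom_pred_le0//; lra.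
elim/ltn_ind => m IHm.
have := conv_ge0 m.
rewrite big_ord_recr/= subnn rising_binom0 mul1r big_ord_recl/= subn0.
rewrite (rising_binomS _ m.+1).
set S := \sum_(i < m) _; set b := rising_binom (1 - nu) m.+1.
(* [S] collects the terms in g_1, ..., g_m, nonnegative by induction, with coefficients of index at
   least 1. *)
have S_le0 : S <= 0.
  apply: sumr_le0 => j _; rewrite /bump/= add1n subSS.
  have -> : (m - j = (m - j).-1.+1)%N by have := ltn_ord j; lia.
  by rewrite mulr_le0_ge0// IHm.
have : b * (g 0%N + (u - nu / m.+2%:R * u)) <= 0.
  by rewrite mulr_le0_ge0 ?b_le0// addrA subr_ge0.
have -> : b * ((1 - nu + m.+1%:R) / m.+2%:R) * u = b * (u - nu / m.+2%:R * u).
  by field; rewrite ?nat1r -?natrD ?pnatr_eq0.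
rewrite mulrDr; set y := b * g 0%N; set z := b * (u - _); clearbody y z S; lra.
Qed.

(** * Euler's integral: limits, recurrence and finiteness *)

Local Notation mu := lebesgue_measure.

Lemma continuous_expRN (R : realType) : continuous (fun s : R => expR (- s)).
Proof.
move=> t; apply: continuous_comp; first exact: continuousN.
exact: continuous_expR.
Qed.

Lemma continuous_powR (R : realType) (x t : R) :
  0 < t -> {for t, continuous (fun s : R => s `^ x)}.
Proof.
move=> t0; apply: differentiable_continuous; apply/derivable1_diffP.
by apply: derivable_powR; rewrite in_itv/= t0.
Qed.

Lemma measurable_powR_expRN (R : realType) (x : R) (D : set R) :
  measurable_fun D (EFin \o (fun t : R => t `^ x * expR (- t))).
Proof.
apply/measurable_EFinP; apply: measurable_funTS; apply: measurable_funM.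
  exact: measurable_powR.
by apply: measurableT_comp => //; exact: measurable_expR.
Qed.

(** For an integer N >= x and t >= 1, e^t >= t^(N + 1) / (N + 1)! gives t^x e^(-t) <= (N + 1)! /
    t. *)
Lemma cvg_powR_expRN (R : realType) (x : R) :
  (fun n : nat => n.+1%:R `^ x * expR (- n.+1%:R) : R) @ \oo --> (0 : R).
Proof.
have [N xN] : exists N : nat, x <= N%:R.
  exists (Num.truncn `|x|).+1; apply: le_trans (ler_norm x) _.
  by apply/ltW; exact: truncnS_gt.
apply: (@squeeze_cvgr _ _ _ _ (fun=> 0) (fun n => N.+1`!%:R * n.+1%:R^-1)).
- apply: nearW => n; apply/andP; split.
    by rewrite mulr_ge0 ?powR_ge0 ?expR_ge0.
  rewrite expRN ler_pdivrMr ?expR_gt0//.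
  have n1 : (1 : R) <= n.+1%:R by rewrite ler1n.
  apply: (le_trans (ler_powR n1 xN)); rewrite powR_mulrn//.
  have /(le_trans _) := expR_ge1Dxn N (ler0n R n.+1).
  move=> /(_ (n.+1%:R ^+ N.+1 / N.+1`!%:R)); rewrite lerDr ler01 => /(_ isT).
  rewrite ler_pdivrMr ?ltr0n ?fact_gt0// exprSr => h.
  by rewrite mulrAC ler_pdivlMr ?ltr0n// [leRHS]mulrC.
- exact: cvg_cst.
- rewrite -[X in _ --> X](mulr0 (N.+1`!%:R : R)).
  by apply: cvgMl_tmp; exact: cvg_harmonic.
Qed.

Lemma cvg_powR_expRN0 (R : realType) (x : R) : 0 < x ->
  (fun n : nat => n.+1%:R^-1 `^ x * expR (- n.+1%:R^-1) : R) @ \oo --> (0 : R).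
Proof.
move=> x0; apply: (@squeeze_cvgr _ _ _ _ (fun=> 0) (fun n => n.+1%:R^-1 `^ x)).
- apply: nearW => n; apply/andP; split.
    by rewrite mulr_ge0 ?powR_ge0 ?expR_ge0.
  by rewrite ler_piMr ?powR_ge0// -expR0 ler_expR oppr_le0 invr_ge0.
- exact: cvg_cst.
- have := powR_cvg0 x0 => /cvg_at_rightP; apply; split.
    by move=> n; rewrite invr_gt0.
  exact: cvg_harmonic.
Qed.

Lemma bigcup_itvcc_inv (R : realType) :
  \bigcup_n `[n.+1%:R^-1, n.+1%:R]%classic = `]0, +oo[%classic :> set R.
Proof.
apply/seteqP; split=> [t [n _]|t]/=; rewrite !in_itv/= ?andbT.
  by move=> /andP[nt _]; apply: lt_le_trans nt; rewrite invr_gt0.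
(* With this index n, n + 1 exceeds t + 1/t, hence both t and 1/t. *)
move=> t0; exists (Num.truncn (t + t^-1)) => //=; rewrite in_itv/=.
have := truncnS_gt (t + t^-1); set N := _.+1%:R => tN.
have ti : 0 < t^-1 by rewrite invr_gt0.
rewrite invf_ple ?posrE// ?ltr0n//.
by apply/andP; split; lra.
Qed.

(** Monotone convergence along the exhaustion of ]0, +oo[; the limit may be +oo. *)
Lemma cvg_itvcc_inv_integral (R : realType) (x : R) :
  (\int[mu]_(t in `[n.+1%:R^-1%R, n.+1%:R%R])
    (t `^ x * expR (- t))%:E)%E @[n --> \oo]
  --> (\int[mu]_(t in `]0%R, +oo[) (t `^ x * expR (- t) : R)%:E)%E.
Proof.
rewrite -bigcup_itvcc_inv.
apply: (@ge0_nondecreasing_set_cvg_integral _ (measurableTypeR R) R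
  (fun n => `[n.+1%:R^-1, n.+1%:R]%classic)
  (fun t => (t `^ x * expR (- t))%:E) mu).
- move=> n m nm; rewrite subsetEset; apply: subset_itvScc; rewrite bnd_simp.
    by rewrite lef_pV2 ?posrE ?ler_nat.
  by rewrite ler_nat.
- by move=> i; exact: measurable_itv.
- by move=> i; exact: measurable_powR_expRN.
- by move=> i t _; rewrite lee_fin mulr_ge0 ?powR_ge0 ?expR_ge0.
Qed.

Lemma integral_powR_expRN_by_parts (R : realType) (x a b : R) :
  0 <= x -> 0 < a -> a < b ->
  (\int[mu]_(t in `[a, b]) (t `^ x * expR (- t))%:E =
   (a `^ x * expR (- a) - b `^ x * expR (- b))%:E
   + x%:E * \int[mu]_(t in `[a, b]) (t `^ (x - 1) * expR (- t))%:E)%E.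
Proof.
move=> x0 a0 ab; have pos t : t \in `[a, b] -> 0 < t.
  by rewrite in_itv/= => /andP[+ _]; exact: lt_le_trans.
have b0 : 0 < b by exact: lt_trans ab.
have contF t : 0 < t -> {for t, continuous (fun s : R => s `^ x)}.
  exact: continuous_powR.
have contG : continuous (fun s : R => - expR (- s)).
  by move=> t; apply: cvgN; exact: continuous_expRN.
rewrite (@integration_by_parts R (fun t => t `^ x) (fun t => - expR (- t))
  (fun t => x * t `^ (x - 1)) (fun t => expR (- t)) a b ab).
- rewrite -ge0_integralZl_EFin//; last 2 first.
  + by move=> t _; rewrite lee_fin mulr_ge0 ?powR_ge0 ?expR_ge0.
  + exact: measurable_powR_expRN.
  have -> : (\int[mu]_(t in `[a, b]) (x * t `^ (x - 1) * - expR (- t))%:E =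
      - \int[mu]_(t in `[a, b]) (x%:E * (t `^ (x - 1) * expR (- t))%:E))%E.
    rewrite -integral_ge0N; last first.
      by move=> t _; rewrite -EFinM lee_fin !mulr_ge0 ?powR_ge0 ?expR_ge0.
    by apply: eq_integral => t _; rewrite -EFinM -EFinN; congr _%:E; ring.
  by rewrite oppeK; congr (_%:E + _)%E; ring.
- apply: continuous_in_subspaceT => t; rewrite inE/= => /pos t0.
  by apply: cvgM; [exact: cvg_cst|exact: continuous_powR].
- split.
  + move=> t tab; apply: derivable_powR.
    by rewrite in_itv/= andbT pos// subset_itv_oo_cc.
  + apply: cvg_at_right_filter; exact: contF.
  + apply: cvg_at_left_filter; exact: contF.
- move=> t tab; rewrite powR_derive1//.
  by rewrite in_itv/= andbT pos// subset_itv_oo_cc.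
- apply: continuous_subspaceT; exact: continuous_expRN.
- split.
  + by move=> t _; apply: ex_derive.
  + apply: cvg_at_right_filter; exact: contG.
  + apply: cvg_at_left_filter; exact: contG.
- move=> t tab; rewrite derive1E derive_val; ring.
Qed.

(** The boundary terms of the integration by parts on [1/n, n] vanish in the limit, the one at 1/n
    because x > 0. Both sides are extended reals, since finiteness is derived later from this
    recurrence. *)
Lemma integral_powR_expRN_rec (R : realType) (x : R) : 0 < x ->
  (\int[mu]_(t in `]0%R, +oo[) (t `^ x * expR (- t))%:E =
   x%:E * \int[mu]_(t in `]0%R, +oo[) (t `^ (x - 1) * expR (- t))%:E)%E.
Proof.
move=> x0.
apply: (@cvg_unique _ (@ereal_hausdorff R) _ _ _ _
  (@cvg_itvcc_inv_integral R x)).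
rewrite /= -[X in _ --> X]add0e.
have lim0 : (fun n : nat => (n.+1%:R^-1 `^ x * expR (- n.+1%:R^-1)
    - n.+1%:R `^ x * expR (- n.+1%:R) : R)%:E) @ \oo --> 0%:E.
  apply: cvg_EFin; first exact: nearW.
  rewrite -[X in _ --> X](subrr (0 : R)).
  by apply: cvgB; [exact: cvg_powR_expRN0|exact: cvg_powR_expRN].
have limI := cvgeZl (erefl : x%:E \is a fin_num)
  (@cvg_itvcc_inv_integral R (x - 1)).
apply: cvg_trans (cvgeD (fin_num_adde_defr _ (erefl : 0%:E \is a fin_num))
  lim0 limI).
(* The interval degenerates to a point at n = 0, so the identity is used for n > 0. *)
apply: near_eq_cvg; near=> n.
rewrite (@integral_powR_expRN_by_parts R x)//; first exact: ltW.
have n1 : 1 < n.+1%:R :> R by rewrite ltr1n ltnS; near: n; exact: nbhs_infty_gt.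
by rewrite (lt_trans _ n1)// invf_lt1 ?ltr0n.
Unshelve. all: by end_near. Qed.

Lemma integral_expRN (R : realType) :
  (\int[mu]_(t in `]0%R, +oo[) (expR (- t) : R)%:E = 1%:E)%E.
Proof.
rewrite integral_itv_obnd_cbnd; last first.
  by apply/measurable_EFinP; apply: measurableT_comp => //; exact: measurable_expR.
rewrite (@ge0_continuous_FTC2y _ _ (fun t : R => - expR (- t)) 0 0).
- by rewrite oppr0 expR0 -EFinB sub0r opprK.
- by move=> t _; exact: expR_ge0.
- apply: continuous_subspaceT; exact: continuous_expRN.
- by rewrite -oppr0; apply: cvgN; exact: cvgr_expR.
- by move=> t _; apply: ex_derive.
- by apply: cvg_at_right_filter; apply: cvgN; exact: continuous_expRN.
- move=> t _; rewrite derive1E derive_val; ring.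
Qed.

Lemma integral_powR_expRN_lty (R : realType) (x : R) : 0 < x -> x <= 1 ->
  (\int[mu]_(t in `]0%R, +oo[) (t `^ (x - 1) * expR (- t))%:E < +oo)%E.
Proof.
(* Dominate t^x by 1 + t in the recurrence. *)
move=> x0 x1; rewrite ltey; apply/eqP => Ioo.
have nneg (y t : R) : (0 <= (t `^ y * expR (- t))%:E)%E.
  by rewrite lee_fin mulr_ge0 ?powR_ge0 ?expR_ge0.
have : (\int[mu]_(t in `]0%R, +oo[) (t `^ x * expR (- t))%:E <=
        \int[mu]_(t in `]0%R, +oo[)
          ((t `^ 0 * expR (- t))%:E + (t `^ 1 * expR (- t))%:E))%E.
  apply: ge0_le_integral => //.
  - exact: measurable_powR_expRN.
  - by apply: emeasurable_funD; exact: measurable_powR_expRN.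
  - move=> t; rewrite /= in_itv/= andbT => t0.
    rewrite -EFinD lee_fin -mulrDl ler_wpM2r ?expR_ge0// powRr0 powRr1 ?(ltW t0)//.
    have [t1|t1] := leP t 1.
      have : t `^ x <= 1 `^ x.
        by apply: ge0_ler_powR; rewrite ?nnegrE//; exact: ltW.
      by rewrite powR1; lra.
    have : t `^ x <= t `^ 1 by rewrite ler_powR// ltW.
    by rewrite powRr1 ?(ltW t0)//; lra.
rewrite ge0_integralD//; try exact: measurable_powR_expRN.
(* The recurrence at x makes the left side +oo, while at 1 it makes the right side 1 + 1. *)
rewrite integral_powR_expRN_rec// (@integral_powR_expRN_rec R 1)// subrr Ioo.
under eq_integral do rewrite powRr0 mul1r.
by rewrite integral_expRN gt0_muley ?lte_fin// mule1 -EFinD leye_eq.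
Qed.

(** * Positivity, functional equation and quotients of Gamma *)

Lemma Gamma_integral_gt0 (R : realType) (x : R) : 0 < x -> x <= 1 ->
  0 < Gamma_integral x.
Proof.
move=> x0 x1; rewrite /Gamma_integral /Rintegral fine_gt0//.
(* Finiteness matters here: [fine] would send +oo to 0. *)
rewrite integral_powR_expRN_lty// andbT.
have sub12 : (`[1%R, 2%R]%classic : set R) `<=` `]0%R, +oo[%classic.
  by move=> t /=; rewrite !in_itv/= andbT => /andP[+ _]; exact: lt_le_trans.
have nneg (t : R) : (0 <= (t `^ (x - 1) * expR (- t))%:E)%E.
  by rewrite lee_fin mulr_ge0 ?powR_ge0 ?expR_ge0.
(* On [1, 2], t^(x - 1) >= 1/t >= 1/2 and e^(-t) >= e^(-2). *)
apply: (@lt_le_trans _ _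
    (\int[mu]_(t in `[1%R, 2%R]) (cst (2^-1 * expR (- 2))%:E t))%E).
  rewrite integral_cst//= lebesgue_measure_itv/= lte_fin ltr1n -EFinB -EFinM.
  by rewrite lte_fin !mulr_gt0 ?expR_gt0//; lra.
apply: (@le_trans _ _
    (\int[mu]_(t in `[1%R, 2%R]) (t `^ (x - 1) * expR (- t))%:E)%E).
  apply: ge0_le_integral => //.
  - by move=> t _; rewrite lee_fin mulr_ge0 ?expR_ge0.
  - exact: measurable_powR_expRN.
  - move=> t; rewrite /= in_itv/= => /andP[t1 t2].
    rewrite lee_fin ler_pM ?expR_ge0//; last by rewrite ler_expR lerN2.
    apply: (@le_trans _ _ (t `^ (- 1))); last by rewrite ler_powR//; lra.
    rewrite powR_inv1 ?(le_trans _ t1)// lef_pV2 ?posrE//.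
    exact: lt_le_trans t1.
apply: ge0_subset_integral => //.
exact: measurable_powR_expRN.
Qed.

Lemma Gamma_integralS (R : realType) (x : R) : 0 < x ->
  Gamma_integral (x + 1) = x * Gamma_integral x.
Proof.
move=> x0; rewrite /Gamma_integral /Rintegral addrK integral_powR_expRN_rec//.
(* [fine] maps +oo to 0, so no finiteness is needed here. *)
case: integral => [r| |] /=; first by [].
- by rewrite gt0_muley ?lte_fin//= mulr0.
- by rewrite mulrNy gtr0_sg// mul1e/= mulr0.
Qed.

Lemma GammaS (R : realType) (x : R) : 0 < x -> Gamma (x + 1) = x * Gamma x.
Proof. by move=> x0; rewrite /Gamma x0 addr_gt0// Gamma_integralS. Qed.

Lemma Gamma1 (R : realType) : Gamma (1 : R) = 1.
Proof.
rewrite /Gamma ltr01 /Gamma_integral /Rintegral subrr.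
under eq_integral do rewrite powRr0 mul1r.
by rewrite integral_expRN.
Qed.

Lemma Gamma_pred (R : realType) (x : R) : 0 < x -> x < 1 ->
  Gamma (x - 1) = Gamma x / (x - 1).
Proof.
move=> x0 x1; rewrite /Gamma x0 ltNge subr_le0 ltW//= opprB.
(* Since 0 < 1 - x < 1, the definition of [Gamma] at x - 1 shifts its argument by exactly one. *)
have -> : Num.truncn (1 - x) = 0%N by apply: truncn_def; apply/andP; split; lra.
by rewrite big_ord1 addr0 subrK.
Qed.

(** By the functional equation, each induction step contributes x + n above and n + 1 below. *)
Lemma Gamma_ratio (R : realType) (x : R) (n : nat) : 0 < x ->
  Gamma (x + n%:R) / Gamma (n%:R + 1) = rising_binom x n * Gamma x.
Proof.
move=> x0; elim: n => [|n IHn].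
  by rewrite addr0 add0r Gamma1 divr1 rising_binom0 mul1r.
have -> : x + n.+1%:R = (x + n%:R) + 1 by rewrite -natr1 addrA.
rewrite !GammaS ?ltr0n ?ltr_wpDr//; rewrite natr1 in IHn.
by rewrite rising_binomS -mulf_div IHn; ring.
Qed.

(** * Falling functions and the Caputo difference as binomial convolutions *)

Lemma falling_div_Gamma (R : realType) (x : R) (n : nat) : 0 < x -> x < 1 ->
  falling (n%:R + x - 1) (x - 1) / Gamma x = rising_binom x n.
Proof.
move=> x0 x1; rewrite /falling /Gamma_pole.
have -> : n%:R + x - 1 + 1 - (x - 1) = n%:R + 1 by ring.
rewrite ifF; last first.
  by apply/negP => /natr_ge0; rewrite oppr_ge0 leNgt ltr_wpDl.
rewrite subrK [n%:R + x]addrC Gamma_ratio// mulfK//.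
by rewrite /Gamma x0 gt_eqF// Gamma_integral_gt0// ltW.
Qed.

(** At x = 2 - nu this is the weight of f(a) in the hypothesis; the factor x - 1 from [Gamma_pred]
    is the extra one in [rising_binom_pred]. *)
Lemma falling_div_Gamma_pred (R : realType) (x : R) (n : nat) : 0 < x -> x < 1 ->
  falling (n%:R + x) (x - 2) / Gamma (x - 1) = rising_binom (x - 1) n.+2.
Proof.
move=> x0 x1; rewrite /falling /Gamma_pole.
have -> : n%:R + x + 1 - (x - 2) = n.+1%:R + 1 + 1 by rewrite -natr1; ring.
rewrite ifF; last first.
  by apply/negP => /natr_ge0; rewrite oppr_ge0 leNgt !ltr_wpDl.
have G0 : Gamma x != 0 by rewrite /Gamma x0 gt_eqF// Gamma_integral_gt0// ltW.
have -> : n%:R + x + 1 = x + n.+1%:R by rewrite -natr1; ring.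
rewrite GammaS ?ltr_wpDl// invfM mulrCA Gamma_ratio// Gamma_pred//.
rewrite rising_binom_pred.
by field; rewrite G0 -natrD pnatr_eq0 subr_eq0 (lt_eqF x1).
Qed.

Lemma delta_sum_nat (R : realType) (a : R) (m : nat) (F : R -> R) :
  delta_sum a (a + m%:R) F = \sum_(j < m.+1) F (a + j%:R).
Proof.
rewrite /delta_sum (fsbig_ord _ _ (fun j => F (a + j%:R))).
apply: reindex_fsbig; split.
- move=> j /=; rewrite ltnS => jm; split; first by exists j.
  by rewrite lerD2l ler_nat.
- by move=> i j _ _ /addrI /eqP; rewrite eqr_nat => /eqP.
- move=> _ [[j _ <-]]; rewrite lerD2l ler_nat => jm.
  by exists j => //=; rewrite ltnS.
Qed.

Lemma iter2_delta_nat (R : realType) (a : R) (f : R -> R) (j : nat) :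
  iter 2 (@delta R) f (a + j%:R) =
  delta f (a + j.+1%:R) - delta f (a + j%:R).
Proof. by rewrite -natr1 addrA. Qed.

Lemma caputo_delta_nat (R : realType) (a nu : R) (f : R -> R) (m : nat) :
  1 < nu -> nu < 2 ->
  caputo_delta a nu f (a + 2 - nu + m%:R) =
  \sum_(j < m.+1) rising_binom (2 - nu) (m - j) *
    (delta f (a + j.+1%:R) - delta f (a + j%:R)).
Proof.
move=> nu1 nu2; rewrite /caputo_delta.
have -> : a + 2 - nu + m%:R - (2 - nu) = a + m%:R by ring.
rewrite delta_sum_nat mulr_sumr; apply: eq_bigr => j _.
have jm : (j <= m)%N by rewrite -ltnS.
(* With x = 2 - nu, t - sigma(s) equals (m - j) + x - 1. *)
rewrite iter2_delta_nat mulrA -falling_div_Gamma; [|lra..].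
rewrite [_^-1 * _]mulrC natrB// /sigma.
by congr (falling _ _ / _ * _); ring.
Qed.

Theorem theorem3p2 (R : realType) (a nu : R) (f : R -> R)
  (nu_gt1 : 1 < nu) (nu_lt2 : nu < 2)
  (caputo_ge : forall t : R, Nset (a + 2 - nu) t ->
     caputo_delta a nu f t >=
       - (falling (t - a) (- nu) / Gamma (1 - nu)) * f a
       - falling (t - a) (1 - nu) / Gamma (2 - nu) * delta f a)
  (fa1_ge : forall k : R, Nset 0 k -> f (a + 1) >= nu / (k + 1) * f a) :
  forall t : R, Nset (a + 1) t -> 0 <= delta f t.
Proof.
pose g (j : nat) := delta f (a + j%:R).
have g0 : g 0%N = f (a + 1) - f a by rewrite /g /delta addr0.
move=> _ [k _ <-]; rewrite -addrA nat1r; move: k.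
apply: (@rising_binom_conv_ge0 _ nu (f a) g); [exact: ltW..| |] => m; last first.
  (* The denominator m + 2 is k + 1 for k = m + 1. *)
  rewrite g0 subrK; have -> : m.+2%:R = m.+1%:R + 1 :> R by rewrite natr1.
  apply: fa1_ge.
  by exists m.+1; rewrite ?add0r.
have tN : Nset (a + 2 - nu) (a + 2 - nu + m%:R) by exists m.
have := caputo_ge _ tN; rewrite caputo_delta_nat//.
have E1 : 1 - nu = 2 - nu - 1 by ring.
have -> : falling (a + 2 - nu + m%:R - a) (- nu) / Gamma (1 - nu) =
    rising_binom (1 - nu) m.+2.
  rewrite E1 -falling_div_Gamma_pred; [|lra..].
  by congr (falling _ _ / _); ring.
(* The same t - a, read above as m + x with x = 2 - nu, is now (m + 1) + x - 1, hence the index m +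
   1. *)
have -> : falling (a + 2 - nu + m%:R - a) (1 - nu) / Gamma (2 - nu) =
    rising_binom (2 - nu) m.+1.
  rewrite -falling_div_Gamma; [|lra..].
  by congr (falling _ _ / _); rewrite -?natr1; ring.
(* The boundary term at [g 0] cancels the Delta f(a) term of the hypothesis. *)
rewrite (rising_binom_conv_delta _ g) -E1 /g addr0.
by rewrite mulNr lerD2r -subr_ge0 opprK.
Qed.
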